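(* Let $(\mathcal T,[1],\Delta)$ be a triangulated category and $\xi$ a proper class of triangles. The intersection of the class of $\xi$-triangulated model structures on $\mathcal T$ and the class of weakly $\xi$-projective model structures on $\mathcal T$ is the class of $\xi$-projective model structures. More explicitly, let $(\mathrm{CoFib},\mathrm{Fib},\mathrm{Weq})$ be a $\xi$-triangulated model structure on $\mathcal T$, with Hovey triple $(\mathcal C,\mathcal F,\mathcal W)$ with respect to $\xi$, i.e. $\mathcal C$, $\mathcal F$, $\mathcal W$ are the classes of cofibrant, fibrant and trivial objects. Then the following are equivalent: (1) it is a weakly $\xi$-projective model structure; (2) it is a $\xi$-projective model structure; (3) $\mathcal T$ has enough $\xi$-projective objects and the class of trivially cofibrant objects coincides with $\mathcal P(\xi)$; (4) $(\mathcal C,\mathcal W)$ is a hereditary complete cotorsion pair with respect to $\xi$, $\mathcal T$ has enough $\xi$-projective objects, and $\mathcal C\cap\mathcal W=\mathcal P(\xi)$.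
   Context: $(\mathcal T,[1],\Delta)$ denotes a triangulated category with suspension autoequivalence $[1]$ (quasi-inverse $[-1]$) and class $\Delta$ of (distinguished) triangles. A triangle $X\xrightarrow{u}Y\xrightarrow{v}Z\xrightarrow{w}X[1]$ is splitting if $w=0$. A class $\xi\subseteq\Delta$ is a proper class of triangles if: (i) it contains all splitting triangles; (ii) it is closed under isomorphisms of triangles, finite coproducts and suspensions (if $X\xrightarrow{u}Y\xrightarrow{v}Z\xrightarrow{w}X[1]$ is in $\xi$ then so is $X[i]\xrightarrow{(-1)^iu[i]}Y[i]\xrightarrow{(-1)^iv[i]}Z[i]\xrightarrow{(-1)^iw[i]}X[i+1]$ for all $i\in\mathbb Z$); (iii) it is closed under base changes (if $X\to Y\to Z\xrightarrow{w}X[1]$ is in $\xi$ and $\alpha:Z'\to Z$ is any morphism, then the triangle $X\to Y'\to Z'\xrightarrow{w\alpha}X[1]$ is in $\xi$) and cobase changes (if moreover $\beta:X\to X'$ is any morphism, then the triangle $X'\to Y'\to Z\xrightarrow{\beta[1]w}X'[1]$ is in $\xi$); (iv) it is saturated: for any triangle $X\to Y\to Z\xrightarrow{w}X[1]$ and any morphism $\alpha:Z'\to Z$ embedded in a triangle $X'\to Z'\xrightarrow{\alpha}Z\to X'[1]$ in $\xi$, if the base change $X\to Y'\to Z'\xrightarrow{w\alpha}X[1]$ is in $\xi$, then $X\to Y\to Z\xrightarrow{w}X[1]$ is in $\xi$. A morphism $u:X\to Y$ is a $\xi$-proper monomorphism if there is a triangle $X\xrightarrow{u}Y\to Z\to X[1]$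 in $\xi$, and a $\xi$-proper epimorphism if there is a triangle $Z[-1]\to X\xrightarrow{u}Y\to Z$ in $\xi$. For $u:X\to Y$, the hocokernel is the object $Z$ in a triangle $X\xrightarrow{u}Y\to Z\to X[1]$, and the hokernel is the object $W$ in a triangle $W\to X\xrightarrow{u}Y\to W[1]$ (unique up to isomorphism). $\mathrm{Ext}_\xi(X,Y)$ is the abelian group (under Baer sum) of equivalence classes of triangles $Y\to E\to X\to Y[1]$ in $\xi$, two such triangles being equivalent if there is a morphism of triangles between them which is the identity on $Y$ and on $X$; the zero element is the class of the splitting triangle. A pair $(\mathcal X,\mathcal Y)$ of classes of objects is a cotorsion pair with respect to $\xi$ if $\mathcal Y=\{Z\mid \mathrm{Ext}_\xi(X,Z)=0\ \forall X\in\mathcal X\}$ and $\mathcal X=\{Z\mid \mathrm{Ext}_\xi(Z,Y)=0\ \forall Y\in\mathcal Y\}$. It is complete if for each $T\in\mathcal T$ there are triangles $Y\to X\to T\to Y[1]$ and $T\to Y'\to X'\to T[1]$ in $\xi$ with $X,X'\in\mathcal X$, $Y,Y'\in\mathcal Y$. It is hereditary if: for every triangle $K\to X_1\to X_2\to K[1]$ in $\xi$ with $X_1,X_2\in\mathcal X$ one has $K\in\mathcal X$; and for every triangle $Y_1\to Y_2\to C\to Y_1[1]$ in $\xi$ with $Y_1,Y_2\in\mathcal Y$ one has $C\in\mathcal Y$. A model structure on a category is a triple $(\mathrm{CoFib},\mathrm{Fib},\mathrm{Weq})$ of classes of morphisms (cofibrations, fibrations, weak equivalences) satisfying: $\mathrm{Weq}$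 has the two-out-of-three property; each class is closed under retracts; every commutative square with left side $i\in\mathrm{CoFib}$ and right side $p\in\mathrm{Fib}$ has a lifting if $i\in\mathrm{Weq}$ or $p\in\mathrm{Weq}$; every morphism factors as $pi=qj$ with $i\in\mathrm{CoFib}\cap\mathrm{Weq}$, $p\in\mathrm{Fib}$, $j\in\mathrm{CoFib}$, $q\in\mathrm{Fib}\cap\mathrm{Weq}$. Trivial cofibrations (fibrations) are the cofibrations (fibrations) in $\mathrm{Weq}$. An object $X$ is cofibrant if $0\to X$ is a cofibration, fibrant if $X\to0$ is a fibration, trivial if $0\to X$ (equivalently $X\to 0$) is a weak equivalence; trivially cofibrant (trivially fibrant) means trivial and cofibrant (fibrant). A model structure on $\mathcal T$ is $\xi$-triangulated if a morphism is a cofibration (respectively, trivial cofibration) if and only if it is a $\xi$-proper monomorphism with cofibrant (respectively, trivially cofibrant) hocokernel, and a morphism is a fibration (respectively, trivial fibration) if and only if it is a $\xi$-proper epimorphism with fibrant (respectively, trivially fibrant) hokernel. For such a model structure, a known theorem says that $(\mathcal C,\mathcal F,\mathcal W)$ is a Hovey triple with respect to $\xi$: $(\mathcal C,\mathcal F\cap\mathcal W)$ and $(\mathcal C\cap\mathcal W,\mathcal F)$ are complete cotorsion pairs with respect to $\xi$, and $\mathcal W$ is closed under isomorphisms and direct summands and, for each triangle in $\xi$ with two of its three objects in $\mathcal W$, contains the third. A model structure is $\xi$-projective if it is $\xi$-triangulated and each object is fibrant. It is weakly $\xi$-projective if the cofibrations are precisely the $\xi$-proper monomorphisms with cofibrant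 hocokernel, the trivial fibrations are precisely the $\xi$-proper epimorphisms with trivially fibrant hokernel, and each object is fibrant. An object $P$ is $\xi$-projective if for any triangle $X\to Y\to Z\to X[1]$ in $\xi$ the sequence $0\to\mathrm{Hom}_{\mathcal T}(P,X)\to\mathrm{Hom}_{\mathcal T}(P,Y)\to\mathrm{Hom}_{\mathcal T}(P,Z)\to0$ is exact; $\mathcal P(\xi)$ is the class of $\xi$-projective objects. $\mathcal T$ has enough $\xi$-projective objects if for any $X\in\mathcal T$ there is a triangle $K\to P\to X\to K[1]$ in $\xi$ with $P\in\mathcal P(\xi)$. *)

(* Defs.v *)
From mathcomp Require Import all_boot all_order all_algebra.
From mathcomp Require Import boolp classical_sets.

Set Implicit Arguments.
Unset Strict Implicit.
Unset Printing Implicit Defensive.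

Import GRing.Theory.
Local Open Scope ring_scope.
Local Open Scope classical_set_scope.

Declare Scope cat_scope.
Delimit Scope cat_scope with cat.
Local Open Scope cat_scope.

Reserved Notation "g ∘ f" (at level 40, left associativity).

(** * Additive categories *)

Record additiveCat := AdditiveCat {
  Ob :> Type;
  Hom : Ob -> Ob -> zmodType;
  idm : forall X, Hom X X;
  compm : forall X Y Z, Hom Y Z -> Hom X Y -> Hom X Z;
  comp1m : forall X Y (f : Hom X Y), compm (idm Y) f = f;
  compm1 : forall X Y (f : Hom X Y), compm f (idm X) = f;
  compmA : forall X Y Z W (h : Hom Z W) (g : Hom Y Z) (f : Hom X Y),
    compm h (compm g f) = compm (compm h g) f;
  compmDl : forall X Y Z (g g' : Hom Y Z) (f : Hom X Y),
    compm (g + g') f = compm g f + compm g' f;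
  compmDr : forall X Y Z (g : Hom Y Z) (f f' : Hom X Y),
    compm g (f + f') = compm g f + compm g f';
  zob : Ob;
  zobP : idm zob = 0;
  biprod : Ob -> Ob -> Ob;
  in1 : forall X Y, Hom X (biprod X Y);
  in2 : forall X Y, Hom Y (biprod X Y);
  pr1 : forall X Y, Hom (biprod X Y) X;
  pr2 : forall X Y, Hom (biprod X Y) Y;
  pr1in1 : forall X Y, compm (pr1 X Y) (in1 X Y) = idm X;
  pr2in2 : forall X Y, compm (pr2 X Y) (in2 X Y) = idm Y;
  pr1in2 : forall X Y, compm (pr1 X Y) (in2 X Y) = 0;
  pr2in1 : forall X Y, compm (pr2 X Y) (in1 X Y) = 0;
  biprodE : forall X Y,
    compm (in1 X Y) (pr1 X Y) + compm (in2 X Y) (pr2 X Y) = idm (biprod X Y)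
}.

Arguments Hom {_} X Y.
Arguments idm {_} X.
Arguments zob {_}.
Arguments biprod {_} X Y.
Arguments in1 {_} X Y.
Arguments in2 {_} X Y.
Arguments pr1 {_} X Y.
Arguments pr2 {_} X Y.
Notation "g ∘ f" := (compm g f) : cat_scope.

Definition inverses (C : additiveCat) (X Y : C) (f : Hom X Y) (g : Hom Y X) :=
  g ∘ f = idm X /\ f ∘ g = idm Y.

Definition is_iso (C : additiveCat) (X Y : C) (f : Hom X Y) :=
  exists g : Hom Y X, inverses f g.

Definition biprod_map (C : additiveCat) (X X' Y Y' : C)
    (f : Hom X Y) (f' : Hom X' Y') : Hom (biprod X X') (biprod Y Y') :=
  in1 Y Y' ∘ f ∘ pr1 X X' + in2 Y Y' ∘ f' ∘ pr2 X X'.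

Record additiveEndo (C : additiveCat) := AdditiveEndo {
  fob :> C -> C;
  fmap : forall X Y, Hom X Y -> Hom (fob X) (fob Y);
  fmap1 : forall X, fmap (idm X) = idm (fob X);
  fmapM : forall X Y Z (g : Hom Y Z) (f : Hom X Y),
    fmap (g ∘ f) = fmap g ∘ fmap f;
  fmapD : forall X Y (f g : Hom X Y), fmap (f + g) = fmap f + fmap g
}.

Fixpoint iter_fmap (C : additiveCat) (F : additiveEndo C) (n : nat) (X Y : C)
    (f : Hom X Y) : Hom (iter n F X) (iter n F Y) :=
  if n is m.+1 then fmap F (iter_fmap F m f) else f.

(** * Candidate triangles *)

Record triangle (C : additiveCat) (F : additiveEndo C) := Tri {
  tX : C; tY : C; tZ : C;
  tu : Hom tX tY;
  tv : Hom tY tZ;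
  tw : Hom tZ (F tX)
}.
Arguments Tri {C F tX tY tZ} tu tv tw.

Section Triangles.
Context {C : additiveCat} {F : additiveEndo C}.
Implicit Types t : triangle F.

Definition splitting t := tw t = 0.

Definition triangle_mor t t' (f : Hom (tX t) (tX t')) (g : Hom (tY t) (tY t'))
    (h : Hom (tZ t) (tZ t')) :=
  [/\ g ∘ tu t = tu t' ∘ f,
      h ∘ tv t = tv t' ∘ g
    & fmap F f ∘ tw t = tw t' ∘ h].

Definition triangle_iso t t' :=
  exists (f : Hom (tX t) (tX t')) (g : Hom (tY t) (tY t'))
         (h : Hom (tZ t) (tZ t')),
    triangle_mor f g h /\ [/\ is_iso f, is_iso g & is_iso h].

(* The third map is the direct sum of [tw t] and [tw t'] followed by the
   canonical isomorphism from [F X (+) F X'] to [F (X (+) X')]. *)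
Definition triangle_sum t t' : triangle F :=
  Tri (biprod_map (tu t) (tu t')) (biprod_map (tv t) (tv t'))
    (fmap F (in1 (tX t) (tX t')) ∘ tw t ∘ pr1 (tZ t) (tZ t')
     + fmap F (in2 (tX t) (tX t')) ∘ tw t' ∘ pr2 (tZ t) (tZ t')).

End Triangles.

(** * Triangulated categories *)

(* The suspension [susp] is an autoequivalence, not an automorphism. The
   quasi-inverse [desusp] is taken with unit and counit satisfying the triangle
   identities, to which any equivalence can be completed; otherwise the
   identification of [X[-1][1]] with [X] could be off by an automorphism of the
   identity functor, and desuspended triangles need not be distinguished. *)
Record triangulatedCat := TriangulatedCat {
  tcat :> additiveCat;
  susp : additiveEndo tcat;
  desusp : additiveEndo tcat;
  eta : forall X, Hom X (desusp (susp X));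
  eta_inv : forall X, Hom (desusp (susp X)) X;
  eps : forall X, Hom (susp (desusp X)) X;
  eps_inv : forall X, Hom X (susp (desusp X));
  etaK : forall X, inverses (eta X) (eta_inv X);
  epsK : forall X, inverses (eps X) (eps_inv X);
  eta_nat : forall X Y (f : Hom X Y),
    eta Y ∘ f = fmap desusp (fmap susp f) ∘ eta X;
  eps_nat : forall X Y (f : Hom X Y),
    f ∘ eps X = eps Y ∘ fmap susp (fmap desusp f);
  eps_eta : forall X, eps (susp X) ∘ fmap susp (eta X) = idm (susp X);
  eta_eps : forall X, fmap desusp (eps X) ∘ eta (desusp X) = idm (desusp X);
  Delta : set (triangle susp);
  TR1_iso : forall t t', triangle_iso t t' -> Delta t -> Delta t';
  TR1_id : forall X : tcat,
    Delta (Tri (idm X) (0 : Hom X zob) (0 : Hom zob (susp X)));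
  TR1_cone : forall (X Y : tcat) (u : Hom X Y),
    exists (Z : tcat) (v : Hom Y Z) (w : Hom Z (susp X)), Delta (Tri u v w);
  TR2 : forall (X Y Z : tcat) (u : Hom X Y) (v : Hom Y Z) (w : Hom Z (susp X)),
    Delta (Tri u v w) <-> Delta (Tri v w (- fmap susp u));
  TR3 : forall (t t' : triangle susp)
      (f : Hom (tX t) (tX t')) (g : Hom (tY t) (tY t')),
    Delta t -> Delta t' -> g ∘ tu t = tu t' ∘ f ->
    exists h : Hom (tZ t) (tZ t'), triangle_mor f g h;
  TR4 : forall (X Y Z X' Y' Z' : tcat)
      (u : Hom X Y) (i : Hom Y Z') (i' : Hom Z' (susp X))
      (v : Hom Y Z) (j : Hom Z X') (j' : Hom X' (susp Y))
      (k : Hom Z Y') (k' : Hom Y' (susp X)),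
    Delta (Tri u i i') -> Delta (Tri v j j') -> Delta (Tri (v ∘ u) k k') ->
    exists (f : Hom Z' Y') (g : Hom Y' X'),
      [/\ Delta (Tri f g (fmap susp i ∘ j')),
          f ∘ i = k ∘ v, k' ∘ f = i', g ∘ k = j
        & j' ∘ g = fmap susp u ∘ k']
}.

Arguments susp {_}.
Arguments desusp {_}.
Arguments eta {_} X.
Arguments eta_inv {_} X.
Arguments eps {_} X.
Arguments eps_inv {_} X.
Arguments Delta {_} _.

Definition tri (T : triangulatedCat) := triangle (@susp T).

Section Shift.
Context {T : triangulatedCat}.
Implicit Types X Y : T.

Definition shift_ob (i : int) X : T :=
  match i with
  | Posz n => iter n susp X
  | Negz n => iter n.+1 desusp X
  end.

Definition shift_map (i : int) X Y (f : Hom X Y) :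
    Hom (shift_ob i X) (shift_ob i Y) :=
  match i with
  | Posz n => iter_fmap susp n f
  | Negz n => iter_fmap desusp n.+1 f
  end.

Fixpoint susp_comm n X : Hom (iter n susp (susp X)) (susp (iter n susp X)) :=
  if n is m.+1 then fmap susp (susp_comm m X) else idm (susp X).

Fixpoint desusp_comm n X :
    Hom (iter n desusp (susp X)) (susp (iter n desusp X)) :=
  if n is m.+1 then
    eps_inv (iter m desusp X) ∘ eta_inv (iter m desusp X)
      ∘ fmap desusp (desusp_comm m X)
  else idm (susp X).

(* The canonical isomorphism from [X[1][i]] to [X[i][1]], both being [X[i+1]]. *)
Definition shift_comm (i : int) X :
    Hom (shift_ob i (susp X)) (susp (shift_ob i X)) :=
  match i with
  | Posz n => susp_comm n X
  | Negz n => desusp_comm n.+1 X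
  end.

Definition shift_tri (i : int) (t : tri T) : tri T :=
  Tri (shift_map i (tu t) *~ (-1) ^ i)
      (shift_map i (tv t) *~ (-1) ^ i)
      ((shift_comm i (tX t) ∘ shift_map i (tw t)) *~ (-1) ^ i).

End Shift.

(** * Proper classes of triangles *)

(* In [pc_base], [pc_cobase] and [pc_saturated], "the" triangle with a given
   third map is any distinguished triangle with that third map. The empty
   coproduct needs no clause in [pc_sum]: it is a splitting triangle. *)
Record proper_class (T : triangulatedCat) (xi : set (tri T)) : Prop := {
  pc_Delta : xi `<=` Delta;
  pc_split : forall t, Delta t -> splitting t -> xi t;
  pc_iso : forall t t', triangle_iso t t' -> xi t -> xi t';
  pc_sum : forall t t', xi t -> xi t' -> xi (triangle_sum t t');
  pc_shift : forall (i : int) t, xi t -> xi (shift_tri i t);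
  pc_base : forall (X Y Z Y' Z' : T)
      (u : Hom X Y) (v : Hom Y Z) (w : Hom Z (susp X)) (a : Hom Z' Z)
      (u' : Hom X Y') (v' : Hom Y' Z'),
    xi (Tri u v w) -> Delta (Tri u' v' (w ∘ a)) -> xi (Tri u' v' (w ∘ a));
  pc_cobase : forall (X Y Z X' Y' : T)
      (u : Hom X Y) (v : Hom Y Z) (w : Hom Z (susp X)) (b : Hom X X')
      (u' : Hom X' Y') (v' : Hom Y' Z),
    xi (Tri u v w) -> Delta (Tri u' v' (fmap susp b ∘ w)) ->
    xi (Tri u' v' (fmap susp b ∘ w));
  pc_saturated : forall (X Y Z X' Y' Z' : T)
      (u : Hom X Y) (v : Hom Y Z) (w : Hom Z (susp X))
      (c : Hom X' Z') (a : Hom Z' Z) (d : Hom Z (susp X'))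
      (u' : Hom X Y') (v' : Hom Y' Z'),
    Delta (Tri u v w) -> xi (Tri c a d) -> xi (Tri u' v' (w ∘ a)) ->
    xi (Tri u v w)
}.

Section ProperClass.
Context {T : triangulatedCat}.
Variable xi : set (tri T).

Definition proper_mono (X Y : T) (u : Hom X Y) :=
  exists (Z : T) (v : Hom Y Z) (w : Hom Z (susp X)), xi (Tri u v w).

(* A triangle [Z[-1] -> X -> Y -> Z]: the last map is composed with the
   identification of [Z] with [Z[-1][1]]. *)
Definition proper_epi (X Y : T) (u : Hom X Y) :=
  exists (Z : T) (a : Hom (desusp Z) X) (v : Hom Y Z),
    xi (Tri a u (eps_inv Z ∘ v)).

Definition is_hocoker (X Y : T) (u : Hom X Y) (Z : T) :=
  exists (v : Hom Y Z) (w : Hom Z (susp X)), Delta (Tri u v w).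

Definition is_hoker (X Y : T) (u : Hom X Y) (W : T) :=
  exists (a : Hom W X) (b : Hom Y (susp W)), Delta (Tri a u b).

Definition proper_mono_hocoker_in (P : set T) (X Y : T) (u : Hom X Y) :=
  proper_mono u /\ exists2 Z, is_hocoker u Z & P Z.

Definition proper_epi_hoker_in (P : set T) (X Y : T) (u : Hom X Y) :=
  proper_epi u /\ exists2 W, is_hoker u W & P W.

(** ** Extensions *)

Record extension (X Y : T) := Extension {
  ext_mid : T;
  ext_in : Hom Y ext_mid;
  ext_pr : Hom ext_mid X;
  ext_w : Hom X (susp Y)
}.

Definition ext_tri (X Y : T) (e : extension X Y) : tri T :=
  Tri (ext_in e) (ext_pr e) (ext_w e).

Definition ext_equiv (X Y : T) (e e' : extension X Y) :=
  exists g : Hom (ext_mid e) (ext_mid e'),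
    @triangle_mor _ _ (ext_tri e) (ext_tri e') (idm Y) g (idm X).

Definition ext_class (X Y : T) (e : extension X Y) : set (extension X Y) :=
  [set e' | xi (ext_tri e') /\ ext_equiv e e'].

Definition Ext (X Y : T) : set (set (extension X Y)) :=
  [set ext_class e | e in [set e | xi (ext_tri e)]].
Arguments Ext X Y : clear implicits.

Definition split_ext (X Y : T) : extension X Y :=
  Extension (in1 Y X) (pr2 Y X) 0.

(* The class of [split_ext] is the neutral element for the Baer sum, so this
   says that the group [Ext X Y] is trivial. *)
Definition Ext_zero (X Y : T) := Ext X Y = [set ext_class (split_ext X Y)].

(** ** Cotorsion pairs *)

Definition cotorsion_pair (A B : set T) :=
  B = [set Z | forall X, A X -> Ext_zero X Z] /\
  A = [set Z | forall Y, B Y -> Ext_zero Z Y].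

Definition complete_pair (A B : set T) :=
  forall M : T,
    (exists (X Y : T) (u : Hom Y X) (v : Hom X M) (w : Hom M (susp Y)),
       [/\ xi (Tri u v w), A X & B Y]) /\
    (exists (X Y : T) (u : Hom M Y) (v : Hom Y X) (w : Hom X (susp M)),
       [/\ xi (Tri u v w), A X & B Y]).

Definition hereditary_pair (A B : set T) :=
  (forall t : tri T, xi t -> A (tY t) -> A (tZ t) -> A (tX t)) /\
  (forall t : tri T, xi t -> B (tX t) -> B (tY t) -> B (tZ t)).

(** ** Projective objects *)

Definition xi_proj : set T := [set P | forall t : tri T, xi t ->
  [/\ forall f : Hom P (tX t), tu t ∘ f = 0 -> f = 0,
      forall g : Hom P (tY t),
        tv t ∘ g = 0 <-> exists f : Hom P (tX t), tu t ∘ f = g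
    & forall h : Hom P (tZ t), exists g : Hom P (tY t), tv t ∘ g = h]].

Definition enough_xi_proj :=
  forall X : T, exists (K P : T) (u : Hom K P) (v : Hom P X)
    (w : Hom X (susp K)), xi (Tri u v w) /\ xi_proj P.

End ProperClass.
Arguments Ext {T} xi X Y.

(** * Model structures *)

Definition morclass (C : additiveCat) := forall X Y : C, Hom X Y -> Prop.

Definition retract (C : additiveCat) (X Y X' Y' : C)
    (f : Hom X Y) (g : Hom X' Y') :=
  exists (i : Hom X X') (r : Hom X' X) (j : Hom Y Y') (s : Hom Y' Y),
    [/\ r ∘ i = idm X, s ∘ j = idm Y, g ∘ i = j ∘ f & f ∘ r = s ∘ g].

Definition retract_closed (C : additiveCat) (K : morclass C) :=
  forall (X Y X' Y' : C) (f : Hom X Y) (g : Hom X' Y'),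
    retract f g -> K _ _ g -> K _ _ f.

Definition two_of_three (C : additiveCat) (K : morclass C) :=
  forall (X Y Z : C) (f : Hom X Y) (g : Hom Y Z),
    [/\ K _ _ f -> K _ _ g -> K _ _ (g ∘ f),
        K _ _ f -> K _ _ (g ∘ f) -> K _ _ g
      & K _ _ g -> K _ _ (g ∘ f) -> K _ _ f].

Definition lifts (C : additiveCat) (A B X Y : C)
    (i : Hom A B) (p : Hom X Y) :=
  forall (a : Hom A X) (b : Hom B Y), p ∘ a = b ∘ i ->
    exists l : Hom B X, l ∘ i = a /\ p ∘ l = b.

Record model_structure (C : additiveCat) := ModelStructure {
  cofib : morclass C;
  fib : morclass C;
  weq : morclass C;
  weq_two_of_three : two_of_three weq;
  cofib_retract : retract_closed cofib;
  fib_retract : retract_closed fib;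
  weq_retract : retract_closed weq;
  model_lift : forall (A B X Y : C) (i : Hom A B) (p : Hom X Y),
    cofib i -> fib p -> weq i \/ weq p -> lifts i p;
  model_fact_tcof : forall (X Y : C) (f : Hom X Y),
    exists (E : C) (i : Hom X E) (p : Hom E Y),
      [/\ f = p ∘ i, cofib i, weq i & fib p];
  model_fact_tfib : forall (X Y : C) (f : Hom X Y),
    exists (E : C) (j : Hom X E) (q : Hom E Y),
      [/\ f = q ∘ j, cofib j, fib q & weq q]
}.

Section Model.
Context {C : additiveCat}.
Variable M : model_structure C.

Definition tcofib : morclass C := fun X Y f => cofib M f /\ weq M f.
Definition tfib : morclass C := fun X Y f => fib M f /\ weq M f.

Definition cofibrant : set C := [set X | cofib M (0 : Hom zob X)].
Definition fibrant : set C := [set X | fib M (0 : Hom X zob)].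
Definition trivial : set C := [set X | weq M (0 : Hom zob X)].

End Model.

Section XiModel.
Context {T : triangulatedCat}.
Variable xi : set (tri T).

Definition xi_triangulated (M : model_structure T) :=
  [/\ forall (X Y : T) (f : Hom X Y),
        cofib M f <-> proper_mono_hocoker_in xi (cofibrant M) f,
      forall (X Y : T) (f : Hom X Y),
        tcofib M f <-> proper_mono_hocoker_in xi (cofibrant M `&` trivial M) f,
      forall (X Y : T) (f : Hom X Y),
        fib M f <-> proper_epi_hoker_in xi (fibrant M) f
    & forall (X Y : T) (f : Hom X Y),
        tfib M f <-> proper_epi_hoker_in xi (fibrant M `&` trivial M) f].

Definition xi_projective_model (M : model_structure T) :=
  xi_triangulated M /\ forall X : T, fibrant M X.

Definition weakly_xi_projective_model (M : model_structure T) :=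
  [/\ forall (X Y : T) (f : Hom X Y),
        cofib M f <-> proper_mono_hocoker_in xi (cofibrant M) f,
      forall (X Y : T) (f : Hom X Y),
        tfib M f <-> proper_epi_hoker_in xi (fibrant M `&` trivial M) f
    & forall X : T, fibrant M X].

End XiModel.

(* Main.v *)
(** A proper class is governed by the ideal of its third maps ("phantom" maps),
    and [Ext X Y = 0] says that every phantom map [X -> Y[1]] vanishes. In a
    triangulated model structure, lifting [0 -> X] against the triangle of a
    phantom map kills it, and conversely each factorization of [0 -> X] or
    [X -> 0] gives a triangle which splits as soon as its third map is zero,
    whence retracts. If the trivially cofibrant objects are projective, the
    triangle of a trivially cofibrant cokernel from factoring [X -> 0] splits,
    so [X] is a retract of a fibrant object; hence all conditions amount to
    every object being fibrant. *)

Require Import Defs.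
From mathcomp Require Import all_boot all_order all_algebra.
From mathcomp Require Import boolp classical_sets.

Set Implicit Arguments.
Unset Strict Implicit.
Unset Printing Implicit Defensive.

Import GRing.Theory Defs.
Local Open Scope ring_scope.
Local Open Scope classical_set_scope.
Local Open Scope cat_scope.

(** * Zero maps and signs in additive categories *)

Section Additive.
Context {C : additiveCat}.
Implicit Types X Y Z W : C.

Lemma comp0m X Y Z (f : Hom X Y) : (0 : Hom Y Z) ∘ f = 0.
Proof. by apply: (addrI (0 ∘ f)); rewrite -compmDl !addr0. Qed.

Lemma compm0 X Y Z (g : Hom Y Z) : g ∘ (0 : Hom X Y) = 0.
Proof. by apply: (addrI (g ∘ 0)); rewrite -compmDr !addr0. Qed.

Lemma compNm X Y Z (g : Hom Y Z) (f : Hom X Y) : (- g) ∘ f = - (g ∘ f).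
Proof. by apply: (addrI (g ∘ f)); rewrite -compmDl !subrr comp0m. Qed.

Lemma compmN X Y Z (g : Hom Y Z) (f : Hom X Y) : g ∘ (- f) = - (g ∘ f).
Proof. by apply: (addrI (g ∘ f)); rewrite -compmDr !subrr compm0. Qed.

Lemma zob_initial X (f : Hom zob X) : f = 0.
Proof. by rewrite -[f]compm1 zobP compm0. Qed.

Lemma zob_terminal X (f : Hom X zob) : f = 0.
Proof. by rewrite -[f]comp1m zobP comp0m. Qed.

Lemma compm_eql X Y Z W (g : Hom Y Z) (f : Hom X Y) (h : Hom X Z)
    (k : Hom W X) :
  g ∘ f = h -> g ∘ (f ∘ k) = h ∘ k.
Proof. by move=> <-; rewrite compmA. Qed.

Lemma is_iso_id X : is_iso (idm X).
Proof. by exists (idm X); split; rewrite comp1m. Qed.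

Variable F : additiveEndo C.

Lemma fmap0 X Y : fmap F (0 : Hom X Y) = 0.
Proof. by apply: (addrI (fmap F 0)); rewrite -fmapD !addr0. Qed.

Lemma fmapN X Y (f : Hom X Y) : fmap F (- f) = - fmap F f.
Proof. by apply: (addrI (fmap F f)); rewrite -fmapD !subrr fmap0. Qed.

End Additive.

(** * Completing, rotating and splitting distinguished triangles *)

Section Triangulated.
Context {T : triangulatedCat}.
Implicit Types X Y Z : T.

Lemma susp_eta X : fmap susp (eta X) = eps_inv (susp X).
Proof.
have [eps_invK epsK] := epsK (susp X).
by rewrite -[LHS]comp1m -eps_invK -compmA eps_eta compm1.
Qed.

Lemma susp_eta_inv X : fmap susp (eta_inv X) = eps (susp X).
Proof.
have [etaK eta_invK] := etaK X.
rewrite -[LHS]comp1m -(eps_eta X) -compmA -fmapM eta_invK fmap1.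
by rewrite compm1.
Qed.

Lemma susp_inj X Y : injective (@fmap _ (@susp T) X Y).
Proof.
move=> f g fg; have [etaK _] := etaK Y.
by rewrite -[f]comp1m -[g]comp1m -etaK -!compmA !eta_nat fg.
Qed.

Lemma susp_full X Y (g : Hom (susp X) (susp Y)) :
  exists f : Hom X Y, fmap susp f = g.
Proof.
exists (eta_inv Y ∘ fmap desusp g ∘ eta X).
by rewrite !fmapM susp_eta_inv -eps_nat -compmA eps_eta compm1.
Qed.

Lemma tri_rotate X Y Z (u : Hom X Y) (v : Hom Y Z) (w : Hom Z (susp X)) :
  Delta (Tri u v w) -> Delta (Tri v w (- fmap susp u)).
Proof. by move/TR2. Qed.

Lemma tri_complete_third X Y Z X' Y' Z'
    (u : Hom X Y) (v : Hom Y Z) (w : Hom Z (susp X))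
    (u' : Hom X' Y') (v' : Hom Y' Z') (w' : Hom Z' (susp X'))
    (f : Hom X X') (g : Hom Y Y') :
  Delta (Tri u v w) -> Delta (Tri u' v' w') ->
  g ∘ u = u' ∘ f ->
  exists2 h : Hom Z Z', h ∘ v = v' ∘ g & fmap susp f ∘ w = w' ∘ h.
Proof.
move=> uvwP uvwP' gu.
have [h [_ hv hw]] := @TR3 T (Tri u v w) (Tri u' v' w') f g uvwP uvwP' gu.
by exists h.
Qed.

(** TR3 applied to the rotated triangles produces the missing map after suspension; [susp] being
    full and faithful brings it back. *)
Lemma tri_complete_first X Y Z X' Y' Z'
    (u : Hom X Y) (v : Hom Y Z) (w : Hom Z (susp X))
    (u' : Hom X' Y') (v' : Hom Y' Z') (w' : Hom Z' (susp X'))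
    (g : Hom Y Y') (h : Hom Z Z') :
  Delta (Tri u v w) -> Delta (Tri u' v' w') ->
  h ∘ v = v' ∘ g ->
  exists2 f : Hom X X', g ∘ u = u' ∘ f & fmap susp f ∘ w = w' ∘ h.
Proof.
move=> uvwP uvwP' hv.
have [k kw gu] := tri_complete_third (tri_rotate uvwP) (tri_rotate uvwP') hv.
have [f fE] := susp_full k; exists f; last by rewrite fE.
by apply: susp_inj; apply: oppr_inj; rewrite !fmapM fE -compmN gu compNm.
Qed.

Lemma tri_complete_middle X Y Z X' Y' Z'
    (u : Hom X Y) (v : Hom Y Z) (w : Hom Z (susp X))
    (u' : Hom X' Y') (v' : Hom Y' Z') (w' : Hom Z' (susp X'))
    (f : Hom X X') (h : Hom Z Z') :
  Delta (Tri u v w) -> Delta (Tri u' v' w') ->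
  fmap susp f ∘ w = w' ∘ h ->
  exists2 g : Hom Y Y', g ∘ u = u' ∘ f & h ∘ v = v' ∘ g.
Proof.
move=> uvwP uvwP' fw.
have [g hv gu] := tri_complete_first (tri_rotate uvwP) (tri_rotate uvwP') fw.
exists g => //; apply: susp_inj; apply: oppr_inj.
by rewrite !fmapM -compmN gu compNm.
Qed.

Section DistinguishedTriangle.
Context {X Y Z : T} {u : Hom X Y} {v : Hom Y Z} {w : Hom Z (susp X)}.
Hypothesis uvwP : Delta (Tri u v w).

Lemma tri_vu : v ∘ u = 0.
Proof.
have [//|h hv _] := tri_complete_third (f := idm X) (g := u) (TR1_id X) uvwP.
by rewrite -hv compm0.
Qed.

Lemma tri_factor A (g : Hom A Y) : v ∘ g = 0 -> exists f : Hom A X, u ∘ f = g.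
Proof.
move=> vg0.
(* Comparing [A -> 0 -> A[1]] with the rotated triangle [Y -> Z -> X[1]] gives a map [A[1] -> X[1]],
   which desuspends to the factorization. *)
have AP : Delta (Tri (0 : Hom A zob) (0 : Hom zob (susp A)) (- fmap susp (idm A))).
  exact/tri_rotate/TR1_id.
have [|h _ hE] :=
    tri_complete_third (f := g) (g := (0 : Hom zob Z)) AP (tri_rotate uvwP).
  by rewrite vg0 comp0m.
have [f fE] := susp_full h; exists f; apply: susp_inj.
rewrite fmapM fE; apply: oppr_inj.
by rewrite -compNm -hE fmap1 compmN compm1.
Qed.

Lemma tri_cofactor A (g : Hom Y A) : g ∘ u = 0 -> exists f : Hom Z A, f ∘ v = g.
Proof.
move=> gu0.
(* Two rotations of the identity triangle give [0 -> A[1] -> A[1]], so the given triangle is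
   suspended as well, by three rotations. *)
have AP : Delta (Tri (0 : Hom zob (susp A)) (- fmap susp (idm A))
                     (- fmap susp 0)).
  exact/tri_rotate/tri_rotate/TR1_id.
have suspP : Delta (Tri (- fmap susp u) (- fmap susp v) (- fmap susp w)).
  exact/tri_rotate/tri_rotate/tri_rotate.
have [|h hE _] := tri_complete_third (f := 0) (g := fmap susp g) suspP AP.
  by rewrite compmN -fmapM gu0 fmap0 oppr0 compm0.
have [f fE] := susp_full h; exists f; apply: susp_inj.
rewrite fmapM fE; apply: oppr_inj.
by rewrite -compmN hE compNm fmap1 comp1m.
Qed.

End DistinguishedTriangle.

Section DistinguishedTriangleRotations.
Context {X Y Z : T} {u : Hom X Y} {v : Hom Y Z} {w : Hom Z (susp X)}.
Hypothesis uvwP : Delta (Tri u v w).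

Lemma tri_wv : w ∘ v = 0.
Proof. exact: (tri_vu (tri_rotate uvwP)). Qed.

Lemma tri_lift A (g : Hom A Z) : w ∘ g = 0 -> exists f : Hom A Y, v ∘ f = g.
Proof. exact: (tri_factor (tri_rotate uvwP)). Qed.

Lemma tri_factor_w A (f : Hom A X) : u ∘ f = 0 ->
  exists g : Hom (susp A) Z, w ∘ g = fmap susp f.
Proof.
move=> uf0; have wuP : Delta (Tri w (- fmap susp u) (- fmap susp v)).
  exact/tri_rotate/tri_rotate.
by apply: (tri_factor wuP); rewrite compNm -fmapM uf0 fmap0 oppr0.
Qed.

Lemma tri_extend A (f : Hom X A) : fmap susp f ∘ w = 0 ->
  exists g : Hom Y A, g ∘ u = f.
Proof.
have wuP : Delta (Tri w (- fmap susp u) (- fmap susp v)).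
  exact/tri_rotate/tri_rotate.
move=> /(tri_cofactor wuP)[h hE]; have [g gE] := susp_full h.
exists (- g); apply: susp_inj.
by rewrite fmapM fmapN gE -hE compNm compmN.
Qed.

End DistinguishedTriangleRotations.

Lemma tri_embed_w X Z (w : Hom Z (susp X)) :
  exists (Y : T) (u : Hom X Y) (v : Hom Y Z), Delta (Tri u v w).
Proof.
have [C [v' [w' wP]]] := TR1_cone w.
have [epsK eps_invK] := epsK C.
have [u uE] := susp_full (- (eps_inv C ∘ v')).
have [v vE] := susp_full (- (w' ∘ eps C)).
(* The cone triangle of [w] rotated back twice, once [C] is replaced by [susp (desusp C)] along
   [eps_inv C]. *)
exists (desusp C), u, v; apply/TR2/TR2; rewrite uE vE !opprK.
apply: TR1_iso wP.
exists (idm Z), (idm (susp X)), (eps_inv C); split; last first.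
  by split; [exact: is_iso_id | exact: is_iso_id | exists (eps C)].
split=> /=; first by rewrite comp1m compm1.
- by rewrite compm1.
- by rewrite fmap1 comp1m -compmA eps_invK compm1.
Qed.

Lemma split_extP X Y : Delta (ext_tri (split_ext X Y)).
Proof.
have [E [u [v uvP]]] := tri_embed_w (0 : Hom X (susp Y)).
have [|s0 s0E] := tri_lift uvP (g := idm X); first exact: comp0m.
have [|r rE] := tri_extend uvP (f := idm Y); first exact: compm0.
have vu0 := tri_vu uvP.
(* Correcting the section [s0] to get [r ∘ s = 0] turns [u], [s], [r], [v] into biproduct data for
   [E]. *)
pose s := s0 - u ∘ r ∘ s0.
have sE : v ∘ s = idm X.
  by rewrite compmDr compmN s0E !compmA vu0 !comp0m subr0.
have rs0 : r ∘ s = 0 by rewrite compmDr compmN !compmA rE comp1m subrr.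
have idE : u ∘ r + s ∘ v = idm E.
  (* The defect kills [u], hence is [k ∘ v]; composing with [s] gives [k = 0]. *)
  have [|k kE] := tri_cofactor uvP (g := idm E - (u ∘ r + s ∘ v)).
    rewrite compmDl compNm compmDl -!compmA rE vu0 compm0 compm1 comp1m.
    by rewrite addr0 subrr.
  apply/esym/eqP; rewrite -subr_eq0 -kE.
  suff -> : k = 0 by rewrite comp0m.
  rewrite -[k]compm1 -sE compmA kE compmDl compNm compmDl -!compmA rs0 sE.
  by rewrite compm0 compm1 comp1m add0r subrr.
apply: TR1_iso uvP.
exists (idm Y), (in1 Y X ∘ r + in2 Y X ∘ v), (idm X); split; last first.
  split; [exact: is_iso_id | | exact: is_iso_id].
  exists (u ∘ pr1 Y X + s ∘ pr2 Y X); split; rewrite compmDl !compmDr.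
  - rewrite -!compmA (compm_eql _ (pr1in1 Y X)) (compm_eql _ (pr1in2 Y X)).
    rewrite (compm_eql _ (pr2in1 Y X)) (compm_eql _ (pr2in2 Y X)).
    by rewrite !comp0m !compm0 !comp1m addr0 add0r idE.
  - rewrite -!compmA (compm_eql _ rE) (compm_eql _ vu0) (compm_eql _ rs0).
    rewrite (compm_eql _ sE).
    by rewrite !comp0m !compm0 !comp1m addr0 add0r biprodE.
split=> /=.
- by rewrite compmDl -!compmA rE vu0 compm0 addr0.
- by rewrite compmDr !compmA pr2in1 pr2in2 comp0m add0r.
- by rewrite comp0m compm0.
Qed.

End Triangulated.

(** * Phantom maps, vanishing of Ext, and projectivity *)

Section Phantom.
Context {T : triangulatedCat} {xi : set (tri T)}.
Hypothesis xiP : proper_class xi.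
Implicit Types X Y Z : T.

Definition phantom X Z (w : Hom Z (susp X)) :=
  exists (Y : T) (u : Hom X Y) (v : Hom Y Z), xi (Tri u v w).

(** Base change along the identity: membership in [xi] depends only on the third map. *)
Lemma phantomP X Y Z (u : Hom X Y) (v : Hom Y Z) (w : Hom Z (susp X)) :
  Delta (Tri u v w) -> phantom w -> xi (Tri u v w).
Proof.
move=> uvwP [Y' [u' [v' xi']]].
rewrite -[w]compm1; apply: (pc_base xiP xi'); by rewrite compm1.
Qed.

Lemma phantom_base X Z Z' (w : Hom Z (susp X)) (a : Hom Z' Z) :
  phantom w -> phantom (w ∘ a).
Proof.
move=> [Y [u [v uvwP]]]; have [Y' [u' [v' P]]] := tri_embed_w (w ∘ a).
exists Y', u', v'; exact: (pc_base xiP uvwP).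
Qed.

Lemma phantom_cobase X X' Z (w : Hom Z (susp X)) (b : Hom X X') :
  phantom w -> phantom (fmap susp b ∘ w).
Proof.
move=> [Y [u [v uvwP]]]; have [Y' [u' [v' P]]] := tri_embed_w (fmap susp b ∘ w).
exists Y', u', v'; exact: (pc_cobase xiP uvwP).
Qed.

(* The dual of saturation: pulling back along the proper epimorphism with
   third map [b[1] w] makes [w] factor through the phantom map [d]. *)
Lemma phantom_cosaturated X X' X'' Z (w : Hom Z (susp X)) (b : Hom X X')
    (c : Hom X' X'') (d : Hom X'' (susp X)) :
  xi (Tri b c d) -> phantom (fmap susp b ∘ w) -> phantom w.
Proof.
move=> bcdP [E [e [a eaP]]].
have bcdD := pc_Delta xiP bcdP.
have cdbP : Delta (Tri d (- fmap susp b) (- fmap susp c)).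
  exact/tri_rotate/tri_rotate.
have [|g gE] := tri_factor cdbP (g := w ∘ a).
  by rewrite compNm compmA (tri_wv (pc_Delta xiP eaP)) oppr0.
have [Y [u [v uvwP]]] := tri_embed_w w.
have [Y' [u' [v' wP]]] : phantom (w ∘ a).
  by rewrite -gE; apply: phantom_base; exists X', b, c.
by exists Y, u, v; apply: (pc_saturated xiP uvwP eaP wP).
Qed.

(** An equivalence is the identity at both ends, so it preserves third maps. Conversely, if all
    third maps vanish, the identities at the ends complete to a middle map between any two
    extensions, leaving a single class. *)
Lemma Ext_zeroP X Y :
  Ext_zero xi X Y <-> forall w : Hom X (susp Y), phantom w -> w = 0.
Proof.
have split_xi : xi (ext_tri (split_ext X Y)).
  by apply: (pc_split xiP) => //; exact: split_extP.
split=> [ext0 w [E [u [v uvwP]]]|ph0].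
  pose e := Extension u v w.
  have : ext_class xi e e.
    split=> //; exists (idm E).
    by split; rewrite /= ?fmap1 !(comp1m, compm1).
  have : Ext xi X Y (ext_class xi e) by exists e.
  rewrite ext0 /= => -> [_ [g [_ _ /= wE]]].
  by rewrite -[w]compm1 -wE compm0.
have w0 (e : extension X Y) : xi (ext_tri e) -> ext_w e = 0.
  by move=> eP; apply: ph0; exists (ext_mid e), (ext_in e), (ext_pr e).
have equiv (e e' : extension X Y) :
    xi (ext_tri e) -> xi (ext_tri e') -> ext_equiv e e'.
  move=> eP e'P.
  suff [g gu vg] : exists2 g : Hom (ext_mid e) (ext_mid e'),
      g ∘ ext_in e = ext_in e' ∘ idm Y & idm X ∘ ext_pr e = ext_pr e' ∘ g.
    exists g; split=> //=.
    by rewrite fmap1 comp1m compm1 w0 // w0.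
  apply: (tri_complete_middle (pc_Delta xiP eP) (pc_Delta xiP e'P)).
  by rewrite !w0 // compm0 comp0m.
have classE (e : extension X Y) : xi (ext_tri e) ->
    ext_class xi e = [set e' | xi (ext_tri e')].
  by move=> eP; apply/seteqP; split=> e' /= => [[]|e'P] //; split=> //; exact: equiv.
apply/seteqP; split=> [_ [e eP <-]|_ ->] /=; first by rewrite !classE.
by exists (split_ext X Y).
Qed.

Lemma xi_projP (P : T) :
  xi_proj xi P <-> forall Y (w : Hom P (susp Y)), phantom w -> w = 0.
Proof.
split=> [projP Y w [E [u [v uvwP]]]|ph0 [X Y Z u v w] uvwP /=].
  have [_ _ /(_ (idm P))[s /= sE]] := projP _ uvwP.
  by rewrite -[w]compm1 -sE compmA (tri_wv (pc_Delta xiP uvwP)) comp0m.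
have uvwD := pc_Delta xiP uvwP.
split=> [f uf0|g|h].
(* For injectivity the triangle is desuspended: its third map is still phantom, and precomposed with
   [fmap desusp g ∘ eta P] it becomes [- (eps_inv X ∘ f)], which must therefore vanish. *)
- have [g gE] := tri_factor_w uvwD uf0.
  have shP := pc_shift xiP (Negz 0) uvwP.
  have : phantom (tw (shift_tri (Negz 0) (Tri u v w)) ∘ (fmap desusp g ∘ eta P)).
    by apply: phantom_base; do 3!eexists; exact: shP.
  move=> /ph0 /=.
  have -> : (-1 : int) ^ Negz 0 = -1 by [].
  rewrite mulrN1z compNm fmap1 compm1 => /eqP.
  rewrite oppr_eq0 => /eqP.
  rewrite -!compmA [fmap desusp w ∘ _]compmA -fmapM gE -eta_nat.
  have [etaK _] := etaK X; have [_ eps_invK] := epsK X.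
  rewrite [eta_inv X ∘ _]compmA etaK comp1m => epsf.
  by rewrite -[f]comp1m -eps_invK -compmA epsf compm0.
- split=> [|[f <-]]; first exact: (tri_factor uvwD).
  by rewrite compmA (tri_vu uvwD) comp0m.
- apply: (tri_lift uvwD); apply: ph0; apply: phantom_base.
  by exists Y, u, v.
Qed.

(** Properness and the hocokernel may come from two different triangles on [u]; a morphism between
    them exhibits one third map as a base change of the other. *)
Lemma proper_mono_hocoker_inP (K : set T) X Y (u : Hom X Y) :
  proper_mono_hocoker_in xi K u <->
  exists (Z : T) (v : Hom Y Z) (w : Hom Z (susp X)), xi (Tri u v w) /\ K Z.
Proof.
split=> [[[Z' [v' [w' xi']]] [Z [v [w uvwP]] KZ]]|[Z [v [w [uvwP KZ]]]]].
  exists Z, v, w; split=> //; apply: phantomP => //.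
  have [|h _ hE] := tri_complete_third (f := idm X) (g := idm Y) uvwP
    (pc_Delta xiP xi').
    by rewrite comp1m compm1.
  rewrite -[w]comp1m -fmap1 hE; apply: phantom_base.
  by exists Y, u, v'.
split; first by exists Z, v, w.
exists Z => //; exists v, w; exact: (pc_Delta xiP).
Qed.

Lemma proper_epi_hoker_inP (K : set T) Y Z (v : Hom Y Z) :
  proper_epi_hoker_in xi K v <->
  exists (X : T) (u : Hom X Y) (w : Hom Z (susp X)), xi (Tri u v w) /\ K X.
Proof.
split=> [[[X' [u' [w' xi']]] [X [u [w uvwP]] KX]]|[X [u [w [uvwP KX]]]]].
  exists X, u, w; split=> //; apply: phantomP => //.
  have [|h _ hE] := tri_complete_first (g := idm Y) (h := idm Z)
    (pc_Delta xiP xi') uvwP.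
    by rewrite comp1m compm1.
  rewrite -[w]compm1 -hE; apply: phantom_cobase.
  by exists Y, u', v.
split; last by exists X => //; exists u, w; exact: (pc_Delta xiP).
(* [proper_epi] wants a hokernel of the form [desusp Z]: take [Z = X[1]] and transport along
   [eta X]. *)
exists (susp X), (u ∘ eta_inv X), w; apply: pc_iso uvwP => //.
have [etaK eta_invK] := etaK X.
exists (eta X), (idm Y), (idm Z); split; last first.
  by split; [exists (eta_inv X) | exact: is_iso_id | exact: is_iso_id].
split=> /=.
- by rewrite -compmA etaK comp1m compm1.
- by rewrite comp1m compm1.
- by rewrite compm1 susp_eta.
Qed.

End Phantom.

Arguments phantom {T} xi {X Z} w.

(** * Retracts of objects, and maps to and from zero, in a model structure *)

Section ModelRetracts.
Context {C : additiveCat} (M : model_structure C).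
Implicit Types X Y : C.

Lemma retract_from_zob X Y (s : Hom X Y) (r : Hom Y X) : r ∘ s = idm X ->
  retract (0 : Hom zob X) (0 : Hom zob Y).
Proof.
move=> rs; exists (idm zob), (idm zob), s, r.
by split=> //; rewrite ?comp1m // !(comp0m, compm0).
Qed.

Lemma retract_to_zob X Y (s : Hom X Y) (r : Hom Y X) : r ∘ s = idm X ->
  retract (0 : Hom X zob) (0 : Hom Y zob).
Proof.
move=> rs; exists s, r, (idm zob), (idm zob).
by split=> //; rewrite ?comp1m // !(comp0m, compm0).
Qed.

(** Two-out-of-three first makes [idm zob] a weak equivalence, and this identity factors as
    [0 -> X -> 0]. *)
Lemma trivial_to_zob X : weq M (0 : Hom X zob) -> trivial M X.
Proof.
move=> X0; have [_ id0 _] := weq_two_of_three M (0 : Hom X zob) (idm zob).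
have [_ _] := weq_two_of_three M (0 : Hom zob X) (0 : Hom X zob).
by apply=> //; rewrite comp0m -zobP; apply: id0 => //; rewrite comp1m.
Qed.

End ModelRetracts.

(** * Orthogonality and approximation in a triangulated model structure *)

Section XiTriangulatedModel.
Context {T : triangulatedCat} {xi : set (tri T)}.
Hypothesis xiP : proper_class xi.
Context {M : model_structure T}.
Hypothesis MP : xi_triangulated xi M.
Implicit Types X Y Z : T.

Lemma lift_phantom0 X Y E (u : Hom Y E) (v : Hom E X) (w : Hom X (susp Y)) :
  xi (Tri u v w) -> lifts (0 : Hom zob X) v -> w = 0.
Proof.
move=> uvwP /(_ 0 (idm X))[|s [_ sE]]; first by rewrite !compm0.
by rewrite -[w]compm1 -sE compmA (tri_wv (pc_Delta xiP uvwP)) comp0m.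
Qed.

Lemma phantom_tcofibrant0 X Y (w : Hom X (susp Y)) :
  cofibrant M X -> trivial M X -> fibrant M Y -> phantom xi w -> w = 0.
Proof.
move=> CX WX FY [E [u [v uvwP]]]; have [_ _ fibP _] := MP.
apply: (lift_phantom0 uvwP); apply: (model_lift CX); last by left.
by apply/fibP/proper_epi_hoker_inP => //; exists Y, u, w.
Qed.

Lemma phantom_cofibrant0 X Y (w : Hom X (susp Y)) :
  cofibrant M X -> fibrant M Y -> trivial M Y -> phantom xi w -> w = 0.
Proof.
move=> CX FY WY [E [u [v uvwP]]]; have [_ _ _ tfibP] := MP.
have [fv Wv] : tfib M v.
  by apply/tfibP/proper_epi_hoker_inP => //; exists Y, u, w.
by apply: (lift_phantom0 uvwP); apply: (model_lift CX fv); right.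
Qed.

(** This and the next three lemmas give the approximation triangles of both complete cotorsion
    pairs, one for each way of factoring [0 -> X] or [X -> 0]. *)
Lemma tcofibrant_cover X : exists (E Y : T) (u : Hom Y E) (v : Hom E X)
    (w : Hom X (susp Y)),
  [/\ xi (Tri u v w), cofibrant M E, trivial M E & fibrant M Y].
Proof.
have [E [i [p [_ Ci Wi]]]] := model_fact_tcof M (0 : Hom zob X).
have [_ _ fibP _] := MP.
move=> /fibP/(proper_epi_hoker_inP xiP)[Y [u [w [uvwP FY]]]].
exists E, Y, u, p, w; rewrite /cofibrant /trivial /=.
by rewrite -(zob_initial i).
Qed.

Lemma cofibrant_cover X : exists (E Y : T) (u : Hom Y E) (v : Hom E X)
    (w : Hom X (susp Y)),
  [/\ xi (Tri u v w), cofibrant M E, fibrant M Y & trivial M Y].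
Proof.
have [E [i [p [_ Ci fp Wp]]]] := model_fact_tfib M (0 : Hom zob X).
have [_ _ _ tfibP] := MP.
have /tfibP/(proper_epi_hoker_inP xiP)[Y [u [w [uvwP [FY WY]]]]] : tfib M p.
  by split.
exists E, Y, u, p, w; rewrite /cofibrant /=.
by rewrite -(zob_initial i).
Qed.

Lemma fibrant_hull X : exists (E Z : T) (u : Hom X E) (v : Hom E Z)
    (w : Hom Z (susp X)),
  [/\ xi (Tri u v w), fibrant M E, cofibrant M Z & trivial M Z].
Proof.
have [E [i [p [_ Ci Wi fp]]]] := model_fact_tcof M (0 : Hom X zob).
have [_ tcofP _ _] := MP.
have /tcofP/(proper_mono_hocoker_inP xiP)[Z [v [w [uvwP [CZ WZ]]]]] : tcofib M i.
  by split.
exists E, Z, i, v, w; rewrite /fibrant /=.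
by rewrite -(zob_terminal p).
Qed.

Lemma tfibrant_hull X : exists (E Z : T) (u : Hom X E) (v : Hom E Z)
    (w : Hom Z (susp X)),
  [/\ xi (Tri u v w), fibrant M E, trivial M E & cofibrant M Z].
Proof.
have [E [i [p [_ Ci fp Wp]]]] := model_fact_tfib M (0 : Hom X zob).
have [cofP _ _ _] := MP.
move: Ci => /cofP/(proper_mono_hocoker_inP xiP)[Z [v [w [uvwP CZ]]]].
have p0 := zob_terminal p; exists E, Z, i, v, w.
by split=> //; [rewrite /fibrant /= -p0 | apply: trivial_to_zob; rewrite -p0].
Qed.

Lemma all_fibrant : cofibrant M `&` trivial M `<=` xi_proj xi ->
  forall X, fibrant M X.
Proof.
move=> CWproj X; have [E [Z [u [v [w [uvwP FE CZ WZ]]]]]] := fibrant_hull X.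
have w0 : w = 0.
  by apply: (proj1 (xi_projP xiP Z)); [exact: CWproj | exists E, u, v].
have [|r rE] := tri_extend (pc_Delta xiP uvwP) (f := idm X).
  by rewrite w0 compm0.
exact: fib_retract (retract_to_zob rE) FE.
Qed.

(** A projective object lifts its identity through a trivially cofibrant cover, hence is a retract
    of it. *)
Lemma proj_tcofibrant : xi_proj xi `<=` cofibrant M `&` trivial M.
Proof.
move=> P projP; have [E [Y [u [v [w [uvwP CE WE _]]]]]] := tcofibrant_cover P.
have [_ _ /(_ (idm P))[s /= sE]] := projP _ uvwP.
have ret := retract_from_zob sE.
by split; [exact: cofib_retract ret CE | exact: weq_retract ret WE].
Qed.

(** * Every object fibrant: projectives and the cotorsion pair of cofibrant and trivial objects *)

Section AllFibrant.
Hypothesis fibrantP : forall X, fibrant M X.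

Lemma tcofibrant_projE : cofibrant M `&` trivial M = xi_proj xi.
Proof.
apply/seteqP; split; last exact: proj_tcofibrant.
move=> P [CP WP]; apply/xi_projP => // Y w.
exact: phantom_tcofibrant0.
Qed.

Lemma enough_proj : enough_xi_proj xi.
Proof.
move=> X; have [E [Y [u [v [w [uvwP CE WE _]]]]]] := tcofibrant_cover X.
by exists Y, E, u, v, w; rewrite -tcofibrant_projE.
Qed.

(** With [trivial_phantomP], this is the cotorsion pair read through [Ext_zeroP]: orthogonality one
    way, splitting of an approximation triangle the other. *)
Lemma cofibrant_phantomP X : cofibrant M X <->
  forall Y (w : Hom X (susp Y)), trivial M Y -> phantom xi w -> w = 0.
Proof.
split=> [CX Y w WY|ph0]; first exact: phantom_cofibrant0.
have [E [Y [u [v [w [uvwP CE _ WY]]]]]] := cofibrant_cover X.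
have [|s sE] := tri_lift (pc_Delta xiP uvwP) (g := idm X).
  by rewrite compm1; apply: ph0 => //; exists E, u, v.
exact: cofib_retract (retract_from_zob sE) CE.
Qed.

Lemma trivial_phantomP Y : trivial M Y <->
  forall X (w : Hom X (susp Y)), cofibrant M X -> phantom xi w -> w = 0.
Proof.
split=> [WY X w CX|ph0]; first exact: phantom_cofibrant0.
have [E [Z [u [v [w [uvwP _ WE CZ]]]]]] := tfibrant_hull Y.
have [|r rE] := tri_extend (pc_Delta xiP uvwP) (f := idm Y).
  by rewrite fmap1 comp1m; apply: ph0 => //; exists E, u, v.
exact: weq_retract (retract_from_zob rE) WE.
Qed.

Lemma cofibrant_trivial_cotorsion :
  cotorsion_pair xi (cofibrant M) (trivial M).
Proof.
split; apply/seteqP; split=> X /=.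
- move=> WX Y CY; apply/Ext_zeroP => // w.
  exact: (proj1 (trivial_phantomP X)).
- move=> ext0; apply/trivial_phantomP => Y w /ext0.
  by move/(Ext_zeroP xiP); apply.
- move=> CX Y WY; apply/Ext_zeroP => // w.
  exact: (proj1 (cofibrant_phantomP X)).
- move=> ext0; apply/cofibrant_phantomP => Y w /ext0.
  by move/(Ext_zeroP xiP); apply.
Qed.

Lemma cofibrant_trivial_complete :
  complete_pair xi (cofibrant M) (trivial M).
Proof.
move=> X; split.
  have [E [Y [u [v [w [uvwP CE _ WY]]]]]] := cofibrant_cover X.
  by exists E, Y, u, v, w.
have [E [Z [u [v [w [uvwP _ WE CZ]]]]]] := tfibrant_hull X.
by exists Z, E, u, v, w.
Qed.

(** Here [X] is trivially fibrant, so [v] is a trivial fibration, and [0 -> Y -> Z] composes weak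
    equivalences. *)
Lemma trivial_hocoker X Y Z (u : Hom X Y) (v : Hom Y Z) (w : Hom Z (susp X)) :
  xi (Tri u v w) -> trivial M X -> trivial M Y -> trivial M Z.
Proof.
move=> uvwP WX WY; have [_ _ _ tfibP] := MP.
have [_ Wv] : tfib M v.
  apply/tfibP/proper_epi_hoker_inP => //; exists X, u, w.
  by do !split=> //; exact: fibrantP.
have [+ _ _] := weq_two_of_three M (0 : Hom zob Y) v.
by rewrite compm0; apply.
Qed.

(* A phantom map [phi : X -> N[1]] with [N] trivial gives [N -> E -> X]. For
   [E -> B] a hull with [B] trivial, [phi] factors through the hocokernel [N']
   of [N -> E -> B]; as [N'] is trivial, the map [X -> N'] extends to [Y], and
   then so does [phi]. *)
Lemma cofibrant_hoker X Y Z (u : Hom X Y) (v : Hom Y Z) (w : Hom Z (susp X)) :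
  xi (Tri u v w) -> cofibrant M Y -> cofibrant M Z -> cofibrant M X.
Proof.
move=> uvwP CY CZ; apply/cofibrant_phantomP => N phi WN [E [a [b abP]]].
have [B [D [j [q [d [jqdP _ WB _]]]]]] := tfibrant_hull E.
have [N' [c [k cP]]] := TR1_cone (j ∘ a).
have [|g gc gk] := tri_complete_third cP (pc_Delta xiP jqdP) (f := a) (g := idm B).
  by rewrite comp1m.
(* The cobase change of [k] along the proper monomorphism [a] is [d ∘ g], phantom because [d] is. *)
have k_phantom : phantom xi k.
  apply: (phantom_cosaturated xiP abP).
  by rewrite gk; apply: (phantom_base xiP); exists B, j, q.
have [|f _ fphi] :=
    tri_complete_third (pc_Delta xiP abP) cP (f := idm N) (g := j).
  by rewrite compm1.
have WN' : trivial M N' by apply: (trivial_hocoker (phantomP xiP cP k_phantom)).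
(* The obstruction to extending [f] is a phantom map [Z -> N'[1]], zero since [Z] is cofibrant and
   [N'] trivial. *)
have [|h hE] := tri_extend (pc_Delta xiP uvwP) (f := f).
  apply: (proj1 (cofibrant_phantomP Z)) WN' _ => //.
  by apply: (phantom_cobase xiP); exists Y, u, v.
(* Now [phi = (k ∘ h) ∘ u], and the phantom map [k ∘ h] vanishes on the cofibrant [Y]. *)
rewrite -[phi]comp1m -fmap1 fphi -hE compmA.
rewrite (proj1 (cofibrant_phantomP Y) CY N (k ∘ h)) ?comp0m //.
exact: (phantom_base xiP).
Qed.

Lemma cofibrant_trivial_hereditary :
  hereditary_pair xi (cofibrant M) (trivial M).
Proof.
by split=> -[X Y Z u v w]; [exact: cofibrant_hoker | exact: trivial_hocoker].
Qed.

End AllFibrant.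

(** The conditions on cofibrations and trivial fibrations are already part of [xi_triangulated]. *)
Lemma weakly_projective_iff_fibrant :
  weakly_xi_projective_model xi M <-> forall X, fibrant M X.
Proof. by case: MP => cofP _ _ tfibP; split=> [[]|]. Qed.

End XiTriangulatedModel.

Theorem proposition8p7 (T : triangulatedCat) (xi : set (tri T))
    (xiP : proper_class xi) :
  [set M : model_structure T | xi_triangulated xi M]
    `&` [set M : model_structure T | weakly_xi_projective_model xi M]
    = [set M : model_structure T | xi_projective_model xi M]
  /\
  forall M : model_structure T, xi_triangulated xi M ->
    [<-> (* (1) *) weakly_xi_projective_model xi M;
         (* (2) *) xi_projective_model xi M;
         (* (3) *) enough_xi_proj xi /\
                   cofibrant M `&` trivial M = xi_proj xi;
         (* (4) *) [/\ [/\ cotorsion_pair xi (cofibrant M) (trivial M),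
                           complete_pair xi (cofibrant M) (trivial M)
                         & hereditary_pair xi (cofibrant M) (trivial M)],
                       enough_xi_proj xi
                     & cofibrant M `&` trivial M = xi_proj xi]].
Proof.
split=> [|M MP].
  apply/seteqP; split=> M /= [MP].
    by move=> /(weakly_projective_iff_fibrant MP).
  by move=> fibP; split=> //; apply/weakly_projective_iff_fibrant.
(* The implications form a cycle from (1) to (4) and back; (3) and (4) recover fibrancy of every
   object from the equality with the projectives. *)
tfae.
- by move=> /(weakly_projective_iff_fibrant MP).
- move=> [_ fibP]; split; first exact: (enough_proj xiP MP fibP).
  exact: (tcofibrant_projE xiP MP fibP).
- move=> [enough projE].
  have fibP : forall X, fibrant M X.
    by apply: (all_fibrant xiP MP); rewrite projE.
  split=> //; split.
  + exact: (cofibrant_trivial_cotorsion xiP MP fibP).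
  + exact: (cofibrant_trivial_complete xiP MP).
  + exact: (cofibrant_trivial_hereditary xiP MP fibP).
- move=> [_ _ projE]; apply/(weakly_projective_iff_fibrant MP).
  by apply: (all_fibrant xiP MP); rewrite projE.
Qed.
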